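(* Let $k$ be a field of characteristic different from $2$ containing an element $i$ with $i^2=-1$. Let $X\subset \mathbf{A}^4_k$ be the affine $k$-variety with coordinates $s,t,u,v$ defined by $$s^2 v(v^2-1) - t^2 u(u^2-1) + uv(u^2-v^2) = 0.$$ Then $X$ is $k$-rational, i.e. its function field is purely transcendental over $k$. *)

(* Defs.v *)
From HB Require Import structures.
From mathcomp Require Import all_boot all_order all_algebra.
Set Implicit Arguments. Unset Strict Implicit. Unset Printing Implicit Defensive.
Import GRing.Theory Num.Theory.
Local Open Scope ring_scope.

Definition mpoly3 (k : nzRingType) := {poly {poly {poly k}}}.
Definition mpoly4 (k : nzRingType) := {poly {poly {poly {poly k}}}}.

(* Evaluation of a 3-variable polynomial (variables x,y,z: x innermost)
   at a point of L^3, coefficients pushed to L via iota. *)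
Definition ev3 (k L : comNzRingType) (iota : {rmorphism k -> L})
  (p : mpoly3 k) (x y z : L) : L :=
  (((map_poly (map_poly (map_poly iota)) p).[z%:P%:P]).[y%:P]).[x].

Definition ev4 (k L : comNzRingType) (iota : {rmorphism k -> L})
  (p : mpoly4 k) (s t u v : L) : L :=
  ((((map_poly (map_poly (map_poly (map_poly iota))) p)
       .[v%:P%:P%:P]).[u%:P%:P]).[t%:P]).[s].

Definition varS (k : nzRingType) : mpoly4 k := 'X%:P%:P%:P.
Definition varT (k : nzRingType) : mpoly4 k := 'X%:P%:P.
Definition varU (k : nzRingType) : mpoly4 k := 'X%:P.
Definition varV (k : nzRingType) : mpoly4 k := 'X.

Definition fX (k : nzRingType) : mpoly4 k :=
  let S := varS k in let T := varT k in let U := varU k in let V := varV k in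
  S ^+ 2 * V * (V ^+ 2 - 1) - T ^+ 2 * U * (U ^+ 2 - 1)
  + U * V * (U ^+ 2 - V ^+ 2).

(* (L, iota, s, t, u, v) is a model of the function field k(X) of the affine
   hypersurface X = {fX = 0}: L is generated as a field over iota(k) by
   s,t,u,v, and the kernel of k[S,T,U,V] -> L, g |-> g(s,t,u,v), is exactly
   the principal ideal (fX). *)
Definition is_function_field_of_X (k L : fieldType) (iota : {rmorphism k -> L})
  (s t u v : L) : Prop :=
  [/\ ev4 iota (fX k) s t u v = 0,
      (forall g : mpoly4 k, ev4 iota g s t u v = 0 ->
          exists h : mpoly4 k, g = h * fX k)
    & (forall w : L, exists g1 g2 : mpoly4 k,
          ev4 iota g2 s t u v != 0 /\
          w = ev4 iota g1 s t u v / ev4 iota g2 s t u v)].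

Definition purely_transcendental3 (k L : fieldType) (iota : {rmorphism k -> L})
  : Prop :=
  exists x y z : L,
    (forall g : mpoly3 k, g != 0 -> ev3 iota g x y z != 0) /\
    (forall w : L, exists g1 g2 : mpoly3 k,
        ev3 iota g2 x y z != 0 /\ w = ev3 iota g1 x y z / ev3 iota g2 x y z).

(* Main.v *)
Require Import Defs.
From HB Require Import structures.
From mathcomp Require Import all_boot all_order all_algebra all_field ring.
Set Implicit Arguments.
Unset Strict Implicit.
Unset Printing Implicit Defensive.
Import GRing.Theory Num.Theory.
Local Open Scope ring_scope.

(** Over k(u, v) the variety is the conic v B s^2 - u A t^2 + u v C = 0 with
    A = u^2 - 1, B = v^2 - 1, C = u^2 - v^2.  Since -1 is a square, the
    associated quaternion algebra is ramified only along u = 0, v = 0 and the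
    line at infinity, with the same residues as (u, v), so the conic is
    isomorphic to the conic v x^2 + u y^2 + 1 = 0, whose function field over k
    is k(x, y, v) because u = - (1 + v x^2) / y^2.  The isomorphism comes from
    an explicit basis a, b, c, orthogonal for u X^2 + v Y^2 + u v Z^2, whose
    elements have norms v A C, - u B C and - u v A B.

    In L = k(x, y, v) this yields s, t, u, v satisfying the equation and
    generating L.  That they satisfy no further relation is seen by
    specializing L at a generic point of X with values in
    M = k(T, U, V)(sqrt d), where x, y, v specialize to the images of the
    generic point under the inverse map. *)

(** * Induction on iterated polynomials *)

Lemma mpoly3_ind (k : nzRingType) (P : mpoly3 k -> Prop) :
    (forall c, P c%:P%:P%:P) -> P 'X%:P%:P -> P 'X%:P -> P 'X ->
    (forall p q, P p -> P q -> P (p + q)) ->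
    (forall p q, P p -> P q -> P (p * q)) ->
  forall p, P p.
Proof.
move=> Pc Px Py Pz PD PM.
elim/poly_ind => [|p a IHp]; first by have := Pc 0; rewrite !polyC0.
apply: (PD); first exact: PM.
elim/poly_ind: a => [|q b IHq]; first by have := Pc 0; rewrite !polyC0.
rewrite polyCD polyCM; apply: (PD); first exact: PM.
elim/poly_ind: b => [|r c IHr]; first by have := Pc 0; rewrite !polyC0.
by rewrite !(polyCD, polyCM); apply: (PD); first exact: PM.
Qed.

Lemma mpoly4_ind (k : nzRingType) (P : mpoly4 k -> Prop) :
    (forall c, P c%:P%:P%:P%:P) ->
    P (varS k) -> P (varT k) -> P (varU k) -> P (varV k) ->
    (forall p q, P p -> P q -> P (p + q)) ->
    (forall p q, P p -> P q -> P (p * q)) ->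
  forall p, P p.
Proof.
move=> Pc Ps Pt Pu Pv PD PM.
elim/poly_ind => [|p a IHp]; first by have := Pc 0; rewrite !polyC0.
apply: (PD); first exact: PM.
elim/(@mpoly3_ind k): a => // p' q IHp' IHq.
  by rewrite polyCD; apply: PD.
by rewrite polyCM; apply: PM.
Qed.

(** * Evaluation as a ring morphism *)

Section Evaluation.
Context (k L : comNzRingType) (iota : {rmorphism k -> L}).

Definition ev3_rmorphism (x y z : L) : {rmorphism mpoly3 k -> L} :=
  horner_eval x \o horner_eval y%:P \o horner_eval z%:P%:P
    \o map_poly (map_poly (map_poly iota)).

Definition ev4_rmorphism (s t u v : L) : {rmorphism mpoly4 k -> L} :=
  horner_eval s \o horner_eval t%:P \o horner_eval u%:P%:P
    \o horner_eval v%:P%:P%:P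
    \o map_poly (map_poly (map_poly (map_poly iota))).

Lemma ev3E p x y z : ev3 iota p x y z = ev3_rmorphism x y z p.
Proof. by []. Qed.

Lemma ev4E p s t u v : ev4 iota p s t u v = ev4_rmorphism s t u v p.
Proof. by []. Qed.

Definition evE := (map_polyC, map_polyX, hornerC, hornerX).

Lemma ev3C c x y z : ev3 iota c%:P%:P%:P x y z = iota c.
Proof. by rewrite /ev3; do !rewrite !evE /=. Qed.
Lemma ev3X x y z : ev3 iota 'X%:P%:P x y z = x.
Proof. by rewrite /ev3; do !rewrite !evE /=. Qed.
Lemma ev3Y x y z : ev3 iota 'X%:P x y z = y.
Proof. by rewrite /ev3; do !rewrite !evE /=. Qed.
Lemma ev3Z x y z : ev3 iota 'X x y z = z.
Proof. by rewrite /ev3; do !rewrite !evE /=. Qed.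
Definition ev3_gen := (ev3C, ev3X, ev3Y, ev3Z).

Lemma ev4C c s t u v : ev4 iota c%:P%:P%:P%:P s t u v = iota c.
Proof. by rewrite /ev4; do !rewrite !evE /=. Qed.
Lemma ev4S s t u v : ev4 iota (varS k) s t u v = s.
Proof. by rewrite /ev4 /varS; do !rewrite !evE /=. Qed.
Lemma ev4T s t u v : ev4 iota (varT k) s t u v = t.
Proof. by rewrite /ev4 /varT; do !rewrite !evE /=. Qed.
Lemma ev4U s t u v : ev4 iota (varU k) s t u v = u.
Proof. by rewrite /ev4 /varU; do !rewrite !evE /=. Qed.
Lemma ev4V s t u v : ev4 iota (varV k) s t u v = v.
Proof. by rewrite /ev4 /varV; do !rewrite !evE /=. Qed.

Lemma ev4D p q s t u v :
  ev4 iota (p + q) s t u v = ev4 iota p s t u v + ev4 iota q s t u v.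
Proof. by rewrite !ev4E rmorphD. Qed.
Lemma ev4M p q s t u v :
  ev4 iota (p * q) s t u v = ev4 iota p s t u v * ev4 iota q s t u v.
Proof. by rewrite !ev4E rmorphM. Qed.

End Evaluation.

(** The structure map k -> L induced by [phi]; with it every morphism out of [mpoly3 k] is
    evaluation at the images of the variables. *)
Definition scalar3 (k L : nzRingType) (phi : {rmorphism mpoly3 k -> L}) :
  {rmorphism k -> L} := phi \o polyC \o polyC \o polyC.

Lemma ev3_scalar3 (k L : comNzRingType) (phi : {rmorphism mpoly3 k -> L}) p :
  ev3 (scalar3 phi) p (phi 'X%:P%:P) (phi 'X%:P) (phi 'X) = phi p.
Proof.
elim/mpoly3_ind: p => [c||||p q IHp IHq|p q IHp IHq]; rewrite ?ev3_gen //.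
  by rewrite ev3E !rmorphD -!ev3E IHp IHq.
by rewrite ev3E !rmorphM -!ev3E IHp IHq.
Qed.

(** * Fractions and their values at a point *)

Lemma fraction_div (R : idomainType) (w : {fraction R}) :
  exists n d : R, d != 0 /\ w = tofrac n / tofrac d.
Proof.
elim/quotW: w => x; exists \n_x, \d_x; split; first exact: denom_ratioP.
have d0 : tofrac \d_x != 0 :> {fraction R} by rewrite tofrac_eq0 denom_ratioP.
(* With the denominator cleared, the product is unfolded to the one on representatives, where
   equality is cross-multiplication. *)
apply: (mulIf d0); rewrite divfK // -[LHS]/(FracField.mul _ _) !piE.
apply/eqmodP; rewrite /= FracField.equivfE /FracField.mulf.
rewrite !numden_Ratio ?(mulf_neq0, oner_neq0, denom_ratioP) //.
by rewrite !mulr1 mulrC.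
Qed.

(* [a] is defined at the point [phi] and takes the value [b] there. *)
Definition specializes (D : idomainType) (F : fieldType)
    (phi : {rmorphism D -> F}) (a : {fraction D}) (b : F) :=
  exists n d, [/\ phi d != 0, a * tofrac d = tofrac n & b * phi d = phi n].

Section Specialization.
Context (D : idomainType) (F : fieldType) (phi : {rmorphism D -> F}).
Notation spec := (specializes phi).

Lemma spec_tofrac n : spec (tofrac n) (phi n).
Proof. by exists n, 1; rewrite !rmorph1 !mulr1 oner_eq0. Qed.

Lemma specD a b a' b' : spec a b -> spec a' b' -> spec (a + a') (b + b').
Proof.
move=> [n [d [d0 ea eb]]] [n' [d' [d0' ea' eb']]].
exists (n * d' + n' * d), (d * d').
rewrite !(tofracD, tofracM, rmorphD, rmorphM) -ea -eb -ea' -eb' mulf_neq0 //.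
by split=> //; ring.
Qed.

Lemma specM a b a' b' : spec a b -> spec a' b' -> spec (a * a') (b * b').
Proof.
move=> [n [d [d0 ea eb]]] [n' [d' [d0' ea' eb']]].
exists (n * n'), (d * d').
rewrite !(tofracM, rmorphM) -ea -eb -ea' -eb' mulf_neq0 //.
by split=> //; ring.
Qed.

Lemma specN a b : spec a b -> spec (- a) (- b).
Proof.
move=> ab; rewrite -mulN1r -(mulN1r b); apply: specM ab.
by have := spec_tofrac (-1); rewrite !rmorphN1.
Qed.

Lemma spec1 : spec 1 1.
Proof. by have := spec_tofrac 1; rewrite !rmorph1. Qed.

Lemma specX a b n : spec a b -> spec (a ^+ n) (b ^+ n).
Proof.
move=> ab; elim: n => [|n IHn]; first exact: spec1.
by rewrite !exprS; apply: specM.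
Qed.

Lemma spec0_eq0 b : spec 0 b -> b = 0.
Proof.
move=> [n [d [d0]]]; rewrite mul0r => /esym/eqP; rewrite tofrac_eq0 => /eqP->.
by rewrite rmorph0 => /eqP; rewrite mulf_eq0 (negPf d0) orbF => /eqP.
Qed.

(** The zero fraction has only the value zero, so nonvanishing lifts from [F] to the fraction field.
    The denominators of the parametrization are handled this way. *)
Lemma spec_neq0 a b : spec a b -> b != 0 -> a != 0.
Proof.
by move=> ab; apply: contra_neq => a0; apply: spec0_eq0; rewrite -a0.
Qed.

Lemma specV a b : b != 0 -> spec a b -> spec a^-1 b^-1.
Proof.
move=> b0 ab; have a0 := spec_neq0 ab b0.
case: ab => n [d [d0 ea eb]]; exists d, n; split.
- by rewrite -eb mulf_neq0.
- by rewrite -ea mulKf.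
by rewrite -eb mulKf.
Qed.

End Specialization.

(** * The equation of X as a quadratic in s *)

Definition X_eq (R : comNzRingType) (s t u v : R) : R :=
  s ^+ 2 * v * (v ^+ 2 - 1) - t ^+ 2 * u * (u ^+ 2 - 1)
  + u * v * (u ^+ 2 - v ^+ 2).

Definition den (R : comNzRingType) (v : R) : R := v * (v ^+ 2 - 1).
Definition num (R : comNzRingType) (t u v : R) : R :=
  t ^+ 2 * u * (u ^+ 2 - 1) - u * v * (u ^+ 2 - v ^+ 2).

Lemma X_eq_den_num (R : comNzRingType) (s t u v : R) :
  X_eq s t u v = den v * s ^+ 2 - num t u v.
Proof. by rewrite /X_eq /den /num; ring. Qed.

(** Together with [X_eq_vsqr1] this covers the roots 0, 1, - 1 of [den]; the values there turn out
    nonzero, so no factor of [den] divides the equation. *)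
Lemma X_eq_v0 (R : comNzRingType) (s t u : R) :
  X_eq s t u 0 = - (t ^+ 2 * (u * (u ^+ 2 - 1))).
Proof. by rewrite /X_eq; ring. Qed.

Lemma X_eq_vsqr1 (R : comNzRingType) (s t u v : R) : v ^+ 2 = 1 ->
  X_eq s t u v = (v - t ^+ 2) * (u * (u ^+ 2 - 1)).
Proof. by move=> v1; rewrite /X_eq v1; ring. Qed.

Section Morphism.
Context (R R' : comNzRingType) (phi : {rmorphism R -> R'}).
Let rE := (rmorphB phi, rmorphD phi, rmorphM phi, rmorphXn phi, rmorph1 phi).

Lemma rmorph_den v : phi (den v) = den (phi v).
Proof. by rewrite /den !rE. Qed.

Lemma rmorph_num t u v : phi (num t u v) = num (phi t) (phi u) (phi v).
Proof. by rewrite /num !rE. Qed.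

Lemma rmorph_X_eq s t u v :
  phi (X_eq s t u v) = X_eq (phi s) (phi t) (phi u) (phi v).
Proof. by rewrite /X_eq !rE. Qed.

End Morphism.

(** * The orthogonal basis and its quadratic identities *)

Section OrthogonalBasis.
Context (R : comNzRingType) (i u v : R).

(* [a] was found by solving u X^2 + v Y^2 + u v Z^2 = v (u^2 - 1) (u^2 - v^2)
   with X, Y, Z of degree at most 2 in u, v; [b] is [a] with u, v and the
   first two coordinates exchanged, i conjugated, and [c] is the rescaled
   cross product of [a] and [b]. *)
Definition a1 := (1 - i) * v * (1 + u).
Definition a2 := v + u ^+ 2 + i * u * (v + 1).
Definition a3 := (1 - i) * (v - u).
Definition b1 := u + v ^+ 2 - i * v * (u + 1).
Definition b2 := (1 + i) * u * (1 + v).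
Definition b3 := (1 + i) * (u - v).
Definition c1 := (1 + i) * v * (1 + u).
Definition c2 := - ((1 - i) * u * (1 + v)).
Definition c3 := v - u - i * (1 - u * v).
(** Up to sign the determinant of the basis a, b, c. *)
Definition disc := (u ^+ 2 - 1) * (v ^+ 2 - 1) * (u ^+ 2 - v ^+ 2).

(* On X the vector B s a + A t b + i C c is isotropic, see [norm_P]. *)
Definition comb (s t a b c : R) :=
  (v ^+ 2 - 1) * s * a + (u ^+ 2 - 1) * t * b + i * (u ^+ 2 - v ^+ 2) * c.
Definition P1 s t := comb s t a1 b1 c1.
Definition P2 s t := comb s t a2 b2 c2.
Definition P3 s t := comb s t a3 b3 c3.

(** Pairings of a, b, c with (v x, u y, 1) for the form u X^2 + v Y^2 + u v Z^2, divided by u v. On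
    the conic v x^2 + u y^2 + 1 = 0 this vector is isotropic. *)
Definition la x y := x * a1 + y * a2 + a3.
Definition lb x y := x * b1 + y * b2 + b3.
Definition lc x y := x * c1 + y * c2 + c3.

Hypothesis i2 : i ^+ 2 = -1.
Implicit Types s t x y : R.

Local Ltac expand :=
  rewrite /X_eq /P1 /P2 /P3 /comb /la /lb /lc /disc
          /a1 /a2 /a3 /b1 /b2 /b3 /c1 /c2 /c3; ring : i2.

Lemma norm_P s t :
  u * P1 s t ^+ 2 + v * P2 s t ^+ 2 + u * v * P3 s t ^+ 2
  = disc * X_eq s t u v.
Proof. expand. Qed.

(** Parseval's identity for (v x, u y, 1) in the orthogonal basis, with denominators cleared. *)
Lemma norm_l x y :
  u * (v ^+ 2 - 1) * la x y ^+ 2 - v * (u ^+ 2 - 1) * lb x y ^+ 2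
    - (u ^+ 2 - v ^+ 2) * lc x y ^+ 2
  = disc * (v * x ^+ 2 + u * y ^+ 2 + 1).
Proof. expand. Qed.

(** Orthogonality leaves one term: the coefficient B s of a times its norm v A C. The next two
    lemmas are the same for b and c. *)
Lemma dot_aP s t :
  u * a1 * P1 s t + v * a2 * P2 s t + u * v * a3 * P3 s t = v * disc * s.
Proof. expand. Qed.

Lemma dot_bP s t :
  u * b1 * P1 s t + v * b2 * P2 s t + u * v * b3 * P3 s t = - (u * disc * t).
Proof. expand. Qed.

Lemma dot_cP s t :
  u * c1 * P1 s t + v * c2 * P2 s t + u * v * c3 * P3 s t
  = - (i * u * v * disc).
Proof. expand. Qed.

(** Expansion of (v x, u y, 1) in the orthogonal basis, first coordinate; the other two follow. *)
Lemma expand_coord1 x y :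
  u * (v ^+ 2 - 1) * la x y * a1 - v * (u ^+ 2 - 1) * lb x y * b1
    - (u ^+ 2 - v ^+ 2) * lc x y * c1 = disc * v * x.
Proof. expand. Qed.

Lemma expand_coord2 x y :
  u * (v ^+ 2 - 1) * la x y * a2 - v * (u ^+ 2 - 1) * lb x y * b2
    - (u ^+ 2 - v ^+ 2) * lc x y * c2 = disc * u * y.
Proof. expand. Qed.

Lemma expand_coord3 x y :
  u * (v ^+ 2 - 1) * la x y * a3 - v * (u ^+ 2 - 1) * lb x y * b3
    - (u ^+ 2 - v ^+ 2) * lc x y * c3 = disc.
Proof. expand. Qed.

End OrthogonalBasis.

Lemma combE (R : comNzRingType) (i u v s t a b c : R) :
  comb i u v s t a b c = (v ^+ 2 - 1) * a * s
    + ((u ^+ 2 - 1) * t * b + i * (u ^+ 2 - v ^+ 2) * c).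
Proof. by rewrite /comb; ring. Qed.

Section BasisMorphism.
Context (R R' : comNzRingType) (phi : {rmorphism R -> R'}) (i u v : R).
Let rE := (rmorphB phi, rmorphN phi, rmorphD phi, rmorphM phi, rmorphXn phi,
           rmorph1 phi).

Lemma rmorph_a2 : phi (a2 i u v) = a2 (phi i) (phi u) (phi v).
Proof. by rewrite /a2 !rE. Qed.
Lemma rmorph_b2 : phi (b2 i u v) = b2 (phi i) (phi u) (phi v).
Proof. by rewrite /b2 !rE. Qed.
Lemma rmorph_c2 : phi (c2 i u v) = c2 (phi i) (phi u) (phi v).
Proof. by rewrite /c2 !rE. Qed.
Lemma rmorph_a3 : phi (a3 i u v) = a3 (phi i) (phi u) (phi v).
Proof. by rewrite /a3 !rE. Qed.
Lemma rmorph_b3 : phi (b3 i u v) = b3 (phi i) (phi u) (phi v).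
Proof. by rewrite /b3 !rE. Qed.
Lemma rmorph_c3 : phi (c3 i u v) = c3 (phi i) (phi u) (phi v).
Proof. by rewrite /c3 !rE. Qed.
Lemma rmorph_disc : phi (disc u v) = disc (phi u) (phi v).
Proof. by rewrite /disc !rE. Qed.

End BasisMorphism.

(** * The parametrization and its inverse *)

Section Parametrization.
Context (F : fieldType) (i u v : F).
Hypothesis i2 : i ^+ 2 = -1.

Let i0 : i != 0.
Proof.
by apply: contra_eq_neq i2 => ->; rewrite expr0n eq_sym oppr_eq0 oner_eq0.
Qed.

Definition conic_u (x y v' : F) := - (1 + v' * x ^+ 2) / y ^+ 2.
(** If ([P1], [P2], [P3]) is proportional to (v x, u y, 1), its pairings with a, b, c are
    proportional to [la], [lb], [lc]. The pairing with c is free of s and t, so dividing by it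
    recovers them. *)
Definition param_s x y := - (i * u * la i u v x y) / lc i u v x y.
Definition param_t x y := i * v * lb i u v x y / lc i u v x y.
Definition inv_x s t := P1 i u v s t / (v * P3 i u v s t).
Definition inv_y s t := P2 i u v s t / (u * P3 i u v s t).

Section Direct.
Variables x y : F.
Hypotheses (lc0 : lc i u v x y != 0) (d0 : disc u v != 0).
Hypotheses (u0 : u != 0) (v0 : v != 0).
Notation s := (param_s x y).
Notation t := (param_t x y).

Lemma param_X_eq : v * x ^+ 2 + u * y ^+ 2 + 1 = 0 -> X_eq s t u v = 0.
Proof.
move=> xy; have := norm_l u v i2 x y; rewrite xy mulr0 => nl.
suff -> : X_eq s t u v = - (u * v / lc i u v x y ^+ 2) *
  (u * (v ^+ 2 - 1) * la i u v x y ^+ 2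
    - v * (u ^+ 2 - 1) * lb i u v x y ^+ 2
    - (u ^+ 2 - v ^+ 2) * lc i u v x y ^+ 2) by rewrite nl mulr0.
by rewrite /X_eq /param_s /param_t; field: i2.
Qed.

(** By the expansions above, ([P1], [P2], [P3]) is then - i [disc] / [lc] times (v x, u y, 1), so
    its ratios give back x and y. *)
Lemma comb_param a b c :
  comb i u v s t a b c = - i / lc i u v x y *
  (u * (v ^+ 2 - 1) * la i u v x y * a
    - v * (u ^+ 2 - 1) * lb i u v x y * b
    - (u ^+ 2 - v ^+ 2) * lc i u v x y * c).
Proof. by rewrite /comb /param_s /param_t; field. Qed.

Let P3E : P3 i u v s t = - i / lc i u v x y * disc u v.
Proof. by rewrite /P3 comb_param expand_coord3. Qed.

Lemma param_inv_x : inv_x s t = x.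
Proof.
rewrite /inv_x P3E /P1 comb_param expand_coord1 //.
by field; rewrite oppr_eq0 i0 d0 v0 lc0.
Qed.

Lemma param_inv_y : inv_y s t = y.
Proof.
rewrite /inv_y P3E /P2 comb_param expand_coord2 //.
by field; rewrite oppr_eq0 i0 d0 u0 lc0.
Qed.

End Direct.

Section Inverse.
Variables s t : F.
Hypotheses (u0 : u != 0) (v0 : v != 0) (d0 : disc u v != 0).
Hypotheses (P2_0 : P2 i u v s t != 0) (P3_0 : P3 i u v s t != 0).
Notation x := (inv_x s t).
Notation y := (inv_y s t).

Lemma conic_u_inv : X_eq s t u v = 0 -> conic_u x y v = u.
Proof.
move=> e; have := norm_P u v i2 s t; rewrite e mulr0 => n.
(* The correction is a multiple of the quadratic form at ([P1], [P2], [P3]), zero on X by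
   [norm_P]. *)
have -> : conic_u x y v = u - u * (u * P1 i u v s t ^+ 2
   + v * P2 i u v s t ^+ 2 + u * v * P3 i u v s t ^+ 2)
    / (v * P2 i u v s t ^+ 2).
  by rewrite /conic_u /inv_x /inv_y; field; rewrite u0 v0 P2_0 P3_0.
by rewrite n mulr0 mul0r subr0.
Qed.

(** At the inverse point the linear forms become the pairings computed in [dot_aP], [dot_bP],
    [dot_cP]. *)
Let linE a b c : x * a + y * b + c =
  (u * a * P1 i u v s t + v * b * P2 i u v s t + u * v * c * P3 i u v s t)
  / (u * v * P3 i u v s t).
Proof. by rewrite /inv_x /inv_y; field; rewrite u0 v0 P3_0. Qed.

Lemma lc_inv_neq0 : lc i u v x y != 0.
Proof.
rewrite /lc linE dot_cP // mulf_neq0 ?oppr_eq0 ?(mulf_neq0 _ d0) //.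
  by rewrite !mulf_neq0.
by rewrite invr_eq0 (mulf_neq0 _ P3_0) // mulf_neq0.
Qed.

Lemma param_s_inv : param_s x y = s.
Proof.
rewrite /param_s /la /lc !linE dot_aP // dot_cP //.
by field; rewrite P3_0 v0 u0 oppr_eq0 !(mulf_neq0 _ d0) ?mulf_neq0.
Qed.

Lemma param_t_inv : param_t x y = t.
Proof.
rewrite /param_t /lb /lc !linE dot_bP // dot_cP //.
by field; rewrite P3_0 v0 u0 oppr_eq0 !(mulf_neq0 _ d0) ?mulf_neq0.
Qed.
End Inverse.
End Parametrization.

(** * A generic point of X over k(T, U, V) *)

(** Unless q = 0, the degree is even on the left and odd on the right. *)
Lemma sqr_eq_X_mul_sqr (D : idomainType) (p q : {poly D}) :
  p ^+ 2 = 'X * q ^+ 2 -> q = 0.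
Proof.
move=> e; apply/eqP/negPn/negP => q0.
have := congr1 (fun r : {poly D} => odd (size r).-1) e.
rewrite size_exp oddM andbF mulrC size_mulX ?expf_neq0 //=.
have s0 : (0 < size (q ^+ 2)%R)%N by rewrite size_poly_gt0 expf_neq0.
by rewrite -(prednK s0) size_exp /= oddM andbF.
Qed.

Section GenericPoint.
Context (k : fieldType).
Notation D := (mpoly3 k).
Let T : D := 'X%:P%:P.
Let U : D := 'X%:P.
Let V : D := 'X.

(* The equation of X reads [s2_den * s ^+ 2 = s2_num]. *)
Definition s2_den : D := den V.
Definition s2_num : D := num T U V.

Lemma lead_s2_den : lead_coef s2_den = 1.
Proof.
have h : ('X^2 - 1 : D) \is monic by rewrite -polyC1 monicXnsubC.
by apply/monicP; rewrite /s2_den /den monicMl ?monicX.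
Qed.

Lemma lead_s2_num : lead_coef s2_num = 'X.
Proof.
set x : {poly {poly k}} := 'X.
have -> : s2_num = x *: 'X^3
   + ((- x ^+ 3)%:P * 'X + ('X%:P ^+ 2 * x * (x ^+ 2 - 1))%:P).
  by rewrite -mul_polyC /s2_num /num /T /U /V !rmorphE /= -/x; ring.
have x0 : x != 0 by rewrite polyX_eq0.
rewrite lead_coefDl ?lead_coefZ ?lead_coefXn ?mulr1 //.
rewrite size_scale // size_polyXn; apply: leq_ltn_trans (_ : (2 < 4)%N) => //.
rewrite size_MXaddC; case: ifP => // _.
by rewrite ltnS size_polyC; case: (_ != _).
Qed.

(* In V the leading coefficients are squares on the left and the variable U
   times a square on the right, so that degrees in U have different parity. *)
Lemma s2_parity (p q : D) : s2_den * p ^+ 2 = s2_num * q ^+ 2 -> q = 0.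
Proof.
move/(congr1 lead_coef); rewrite (lead_coefM s2_den) (lead_coefM s2_num).
rewrite lead_s2_den lead_s2_num mul1r !lead_coef_exp => /sqr_eq_X_mul_sqr/eqP.
by rewrite lead_coef_eq0 => /eqP.
Qed.

Lemma s2_den_neq0 : s2_den != 0.
Proof. by rewrite -lead_coef_eq0 lead_s2_den oner_eq0. Qed.

End GenericPoint.

(** A quadratic polynomial without roots is irreducible, so a root of it can be adjoined. *)
Lemma sqrt_extension (F : fieldType) (d : F) :
  (forall x, x ^+ 2 != d) ->
  exists (M : fieldType) (j : {rmorphism F -> M}) (r : M), r ^+ 2 = j d.
Proof.
move=> nsq.
have irr : irreducible_poly ('X^2 - d%:P).
  apply: cubic_irreducible; first by rewrite size_XnsubC.
  by move=> x; rewrite rootE !hornerE subr_eq0.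
have [M _ [r + _]] := irredp_FAdjoin irr.
rewrite rmorphB /= map_polyXn map_polyC rootE !hornerE subr_eq0 => /eqP e.
by exists M, (GRing.in_alg M), r.
Qed.

Lemma sqr_div_eq (F : fieldType) (a b n d : F) :
  a != 0 -> d != 0 -> (n / d) ^+ 2 = b / a -> a * n ^+ 2 = b * d ^+ 2.
Proof.
move=> a0 d0 e; have -> : a * n ^+ 2 = a * (n / d) ^+ 2 * d ^+ 2 by field.
by rewrite e; field.
Qed.

(** A square root S of [s2_num] / [s2_den] is adjoined to k(T, U, V), where this quotient is not a
    square by [s2_parity]. The last clause makes 1 and S independent: p S = - q gives [s2_den] q^2 =
    [s2_num] p^2, hence p = 0. *)
Lemma generic_point (k : fieldType) :
  exists (M : fieldType) (j : {rmorphism mpoly3 k -> M}) (S : M),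
  [/\ injective j, j (s2_den k) * S ^+ 2 = j (s2_num k)
    & forall p q, j p * S + j q = 0 -> p = 0].
Proof.
have den0 : tofrac (s2_den k) != 0 by rewrite tofrac_eq0 s2_den_neq0.
case: (@sqrt_extension _ (tofrac (s2_num k) / tofrac (s2_den k))) => [x|].
  have [n [d [d0 ->]]] := fraction_div x.
  have d0' : tofrac d != 0 by rewrite tofrac_eq0.
  apply: contra_neq d0 => /(sqr_div_eq den0 d0').
  rewrite -!tofracXn -!tofracM => /eqP; rewrite tofrac_eq => /eqP.
  exact: s2_parity.
move=> M [j [S e]].
pose jj : {rmorphism mpoly3 k -> M} := j \o @tofrac _.
have jE : j (tofrac (s2_den k)) * S ^+ 2 = j (tofrac (s2_num k)).
  by rewrite e -rmorphM mulrC divfK.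
have inj : injective jj.
  by move=> p q /fmorph_inj/eqP; rewrite tofrac_eq => /eqP.
exists M, jj, S; split=> // p q /eqP; rewrite addr_eq0 => /eqP pq.
apply: (@s2_parity _ q); apply: inj.
rewrite (rmorphM jj (s2_den k)) (rmorphM jj (s2_num k)) !rmorphXn /= -jE.
have -> : j (tofrac q) = - (j (tofrac p) * S) by rewrite pq opprK.
by ring.
Qed.

(** * The ideal of the generic point by pseudo-division *)

(** At c the left side vanishes and f does not, so X - c divides q and cancels. *)
Lemma cancel_XsubC (D : idomainType) (f g q : {poly D}) (c : D) :
  ~~ root f c -> ('X - c%:P) * g = q * f -> exists q', g = q' * f.
Proof.
move=> fc e.
have /factor_theorem[q' eq'] : root q c.
  have := congr1 (fun p => root p c) e.
  by rewrite !rootM (negPf fc) orbF root_XsubC eqxx => <-.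
exists q'; apply: (@mulfI _ ('X - c%:P)); first by rewrite polyXsubC_eq0.
by rewrite e eq' mulrA (mulrC q').
Qed.

(* Division of [g] by [e a * s ^+ 2 - e N] in the variable [s], which is the
   innermost one in [mpoly4 k], so that [poly] division does not apply. *)
Section PseudoDivisionStep.
Context (A B : comNzRingType) (e : {rmorphism A -> B}) (a N : A) (s : B).

Definition pseudo_divides (g : B) := exists n (q : B) (r1 r0 : A),
  e a ^+ n * g = q * (e a * s ^+ 2 - e N) + e r1 * s + e r0.

Lemma pseudo_divides_coef r : pseudo_divides (e r).
Proof. by exists 0, 0, 0, r; rewrite !rmorph0 !mul0r mul1r !add0r. Qed.

Lemma pseudo_divides_var : pseudo_divides s.
Proof.
by exists 0, 0, 1, 0; rewrite rmorph0 rmorph1 !mul1r mul0r add0r addr0.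
Qed.

Lemma pseudo_dividesD g g' :
  pseudo_divides g -> pseudo_divides g' -> pseudo_divides (g + g').
Proof.
move=> [n [q [r1 [r0 E]]]] [n' [q' [r1' [r0' E']]]].
exists (n + n')%N, (e a ^+ n' * q + e a ^+ n * q'),
  (a ^+ n' * r1 + a ^+ n * r1'), (a ^+ n' * r0 + a ^+ n * r0').
transitivity (e a ^+ n' * (e a ^+ n * g) + e a ^+ n * (e a ^+ n' * g')).
  by rewrite exprD; ring.
by rewrite E E' !(rmorphD, rmorphM, rmorphXn); ring.
Qed.

Lemma pseudo_dividesM g g' :
  pseudo_divides g -> pseudo_divides g' -> pseudo_divides (g * g').
Proof.
move=> [n [q [r1 [r0 E]]]] [n' [q' [r1' [r0' E']]]].
(* The extra factor [e a] is spent on the term r1 r1' s^2, where a s^2 becomes N modulo the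
   divisor. *)
exists (n + n').+1, (e a * (q * q' * (e a * s ^+ 2 - e N)
      + q * (e r1' * s + e r0') + q' * (e r1 * s + e r0)) + e r1 * e r1'),
  (a * (r1 * r0' + r0 * r1')), (a * (r0 * r0') + r1 * r1' * N).
transitivity (e a * (e a ^+ n * g) * (e a ^+ n' * g')).
  by rewrite exprS exprD; ring.
by rewrite E E' !(rmorphD, rmorphM); ring.
Qed.

(** The remainder vanishes under [ev], and independence of 1 and [ev s] kills both its
    coefficients. *)
Lemma pseudo_ker (M : idomainType) (ev : {rmorphism B -> M})
    (j : {rmorphism A -> M}) g :
  (forall r, ev (e r) = j r) -> injective j -> j a * ev s ^+ 2 = j N ->
  (forall p q, j p * ev s + j q = 0 -> p = 0) ->
  pseudo_divides g -> ev g = 0 ->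
  exists n q, e a ^+ n * g = q * (e a * s ^+ 2 - e N).
Proof.
move=> evE inj js ind [n [q [r1 [r0 E]]]] g0; exists n, q.
have := congr1 ev E.
rewrite !(rmorphB, rmorphM, rmorphD, rmorphXn) !evE js subrr g0 !mulr0 add0r.
move=> /esym r01; have r10 := ind _ _ r01.
have r00 : r0 = 0.
  by apply: inj; move: r01; rewrite r10 rmorph0 mul0r add0r.
by rewrite E r10 r00 !rmorph0 mul0r !addr0.
Qed.

End PseudoDivisionStep.

Section PseudoDivision.
Context (k : fieldType).

Definition embTUV : {rmorphism mpoly3 k -> mpoly4 k} :=
  map_poly (map_poly (map_poly polyC)).

Lemma embT : embTUV 'X%:P%:P = varT k.
Proof. by rewrite /embTUV /varT /=; do !rewrite !evE /=. Qed.
Lemma embU : embTUV 'X%:P = varU k.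
Proof. by rewrite /embTUV /varU /=; do !rewrite !evE /=. Qed.
Lemma embV : embTUV 'X = varV k.
Proof. by rewrite /embTUV /varV /=; do !rewrite !evE /=. Qed.
Lemma embC c : embTUV c%:P%:P%:P = c%:P%:P%:P%:P.
Proof. by rewrite /embTUV /=; do !rewrite !evE /=. Qed.

Lemma fXE : fX k = X_eq (varS k) (varT k) (varU k) (varV k).
Proof. by []. Qed.

Lemma fX_s2 :
  fX k = embTUV (s2_den k) * varS k ^+ 2 - embTUV (s2_num k).
Proof. by rewrite fXE X_eq_den_num rmorph_den rmorph_num embT embU embV. Qed.

Lemma pseudo_div (g : mpoly4 k) :
  pseudo_divides embTUV (s2_den k) (s2_num k) (varS k) g.
Proof.
elim/mpoly4_ind: g => [c||||| g g' | g g'].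
- by rewrite -embC; apply: pseudo_divides_coef.
- exact: pseudo_divides_var.
- by rewrite -embT; apply: pseudo_divides_coef.
- by rewrite -embU; apply: pseudo_divides_coef.
- by rewrite -embV; apply: pseudo_divides_coef.
- exact: pseudo_dividesD.
exact: pseudo_dividesM.
Qed.

Lemma subX2_neq0 (D : idomainType) (c : D) : 'X^2 - c%:P != 0.
Proof. by apply: monic_neq0; apply: monicXnsubC. Qed.

Lemma fX_horner (c : {poly {poly {poly k}}}) :
  (fX k).[c] = X_eq 'X%:P%:P 'X%:P 'X c.
Proof.
rewrite -/(horner_eval c (fX k)) fXE rmorph_X_eq /= /horner_eval.
by rewrite /varS /varT /varU /varV !hornerC hornerX.
Qed.

Lemma den_polyX (D : comNzRingType) :
  den 'X = ('X - 0%:P) * (('X - 1%:P) * ('X - (- 1)%:P)) :> {poly D}.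
Proof. by rewrite /den polyC0 polyCN polyC1; ring. Qed.

Lemma U_den_neq0 : 'X * ('X ^+ 2 - 1) != 0 :> {poly {poly {poly k}}}.
Proof. by rewrite mulf_neq0 ?polyX_eq0 // -polyC1 subX2_neq0. Qed.

Lemma fX_not_root0 : ~~ root (fX k) 0.
Proof.
rewrite rootE fX_horner X_eq_v0 oppr_eq0 (mulf_neq0 _ U_den_neq0) //.
by rewrite expf_neq0 // polyC_eq0 polyX_eq0.
Qed.

Let cst : {rmorphism k -> {poly {poly {poly k}}}} := polyC \o polyC \o polyC.

Lemma fX_not_root_sqr1 (e : k) : e ^+ 2 = 1 -> ~~ root (fX k) (cst e).
Proof.
move=> e1; have csqr : cst e ^+ 2 = 1 by rewrite -(rmorphXn cst) e1 rmorph1.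
rewrite rootE fX_horner X_eq_vsqr1 // (mulf_neq0 _ U_den_neq0) //.
by rewrite -opprB oppr_eq0 /= -polyC_exp -polyCB polyC_eq0 subX2_neq0.
Qed.

Lemma fX_not_root1 : ~~ root (fX k) 1.
Proof. by rewrite -(rmorph1 cst) fX_not_root_sqr1 ?expr1n. Qed.

Lemma fX_not_rootN1 : ~~ root (fX k) (- 1).
Proof. by rewrite -(rmorphN1 cst) fX_not_root_sqr1 ?sqrrN ?expr1n. Qed.

(** The factors V, V - 1, V + 1 of [s2_den] do not divide [fX], so they cancel one by one. *)
Lemma fX_dvd_cancel n (g q : mpoly4 k) :
  embTUV (s2_den k) ^+ n * g = q * fX k -> exists h, g = h * fX k.
Proof.
have den : embTUV (s2_den k) = ('X - 0%:P) * (('X - 1%:P) * ('X - (- 1)%:P)).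
  by rewrite rmorph_den embV; apply: den_polyX.
elim: n q => [|n IHn] q; first by rewrite expr0 mul1r => ->; exists q.
rewrite exprS den -!mulrA.
move=> /(cancel_XsubC fX_not_root0)[q1].
move=> /(cancel_XsubC fX_not_root1)[q2].
move=> /(cancel_XsubC fX_not_rootN1)[q3].
by rewrite -den => /IHn.
Qed.

End PseudoDivision.

(** Pseudo-division makes a power of [s2_den] times g a multiple of [fX]; that power then
    cancels. *)
Lemma ker_generic_point (k M : fieldType) (j : {rmorphism mpoly3 k -> M})
    (S : M) (g : mpoly4 k) :
  injective j -> j (s2_den k) * S ^+ 2 = j (s2_num k) ->
  (forall p q, j p * S + j q = 0 -> p = 0) ->
  ev4 (scalar3 j) g S (j 'X%:P%:P) (j 'X%:P) (j 'X) = 0 ->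
  exists h, g = h * fX k.
Proof.
move=> inj jS ind.
pose ev := ev4_rmorphism (scalar3 j) S (j 'X%:P%:P) (j 'X%:P) (j 'X).
have evS : ev (varS k) = S by rewrite -ev4E ev4S.
have evemb r : ev (embTUV k r) = j r.
  elim/mpoly3_ind: r => [c||||p q IHp IHq|p q IHp IHq].
  - by rewrite embC -ev4E ev4C.
  - by rewrite embT -ev4E ev4T.
  - by rewrite embU -ev4E ev4U.
  - by rewrite embV -ev4E ev4V.
  - by rewrite (rmorphD (embTUV k)) (rmorphD ev) (rmorphD j) IHp IHq.
  by rewrite (rmorphM (embTUV k)) (rmorphM ev) (rmorphM j) IHp IHq.
have jS' : j (s2_den k) * ev (varS k) ^+ 2 = j (s2_num k) by rewrite evS.
have ind' p q : j p * ev (varS k) + j q = 0 -> p = 0 by rewrite evS; apply: ind.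
move=> g0.
have [n [q]] := pseudo_ker evemb inj jS' ind' (pseudo_div g) g0.
by rewrite -fX_s2; apply: fX_dvd_cancel.
Qed.

(** * Values of the parametrization at a point of X *)

Section SpecializeParam.
Context (D : idomainType) (M : fieldType) (phi : {rmorphism D -> M}).
Notation L := {fraction D}.
Notation spec := (specializes phi).
Variables (i x y v : L) (I S T U V : M).
Hypotheses (i2 : i ^+ 2 = -1) (I2 : I ^+ 2 = -1).
Hypotheses (U0 : U != 0) (V0 : V != 0) (d0 : disc U V != 0).
Hypotheses (P2_0 : P2 I U V S T != 0) (P3_0 : P3 I U V S T != 0).
Hypothesis ST : X_eq S T U V = 0.
Notation X := (inv_x I U V S T).
Notation Y := (inv_y I U V S T).
Hypotheses (spi : spec i I) (spx : spec x X) (spy : spec y Y) (spv : spec v V).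
Let u : L := conic_u x y v.
Let s : L := param_s i u v x y.
Let t : L := param_t i u v x y.

Local Ltac spec_tac := repeat first
  [ assumption | apply: spec1 | apply: specN | apply: specD | apply: specX
  | apply: specM ].

Let Y0 : Y != 0.
Proof. by rewrite /inv_y mulf_neq0 // invr_eq0 mulf_neq0. Qed.

(** On X the inverse map followed by the parametrization is the identity, so the formula for u takes
    the value U at (X, Y, V); likewise for s and t below. *)
Lemma specializes_param_u : spec u U.
Proof.
rewrite -(conic_u_inv I2 U0 V0 P2_0 P3_0 ST) /u /conic_u.
apply: specM; last by apply: specV; [rewrite expf_neq0 | spec_tac].
by spec_tac.
Qed.

Let lc0' := lc_inv_neq0 I2 U0 V0 d0 P3_0.

Let sp_lc : spec (lc i u v x y) (lc I U V X Y).
Proof.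
by have := specializes_param_u; rewrite /lc /c1 /c2 /c3 => spu; spec_tac.
Qed.

Lemma specializes_param_s : spec s S.
Proof.
rewrite -(param_s_inv I2 U0 V0 d0 P3_0) /s /param_s.
apply: specM; last exact: specV.
by have := specializes_param_u; rewrite /la /a1 /a2 /a3 => spu; spec_tac.
Qed.

Lemma specializes_param_t : spec t T.
Proof.
rewrite -(param_t_inv I2 U0 V0 d0 P3_0) /t /param_t.
apply: specM; last exact: specV.
by have := specializes_param_u; rewrite /lb /b1 /b2 /b3 => spu; spec_tac.
Qed.

Let lc0 : lc i u v x y != 0.
Proof. exact: spec_neq0 sp_lc lc0'. Qed.
Let y0 : y != 0. Proof. exact: spec_neq0 spy Y0. Qed.
Let u0 : u != 0. Proof. exact: spec_neq0 specializes_param_u U0. Qed.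
Let v0 : v != 0. Proof. exact: spec_neq0 spv V0. Qed.
Let disc0 : disc u v != 0.
Proof.
have spu := specializes_param_u; apply: (@spec_neq0 _ _ phi) d0; rewrite /disc.
by spec_tac.
Qed.

Lemma param_on_X : X_eq s t u v = 0.
Proof.
apply: (param_X_eq i2 lc0).
by rewrite /u /conic_u divfK ?expf_neq0 //; ring.
Qed.

Lemma param_x : inv_x i u v s t = x.
Proof. by apply: param_inv_x. Qed.

Lemma param_y : inv_y i u v s t = y.
Proof. by apply: param_inv_y. Qed.

End SpecializeParam.

(** Values are compatible with ring operations, so a relation between s, t, u, v passes to S, T, U,
    V. *)
Lemma spec_ev4 (k D : idomainType) (M : fieldType) (phi : {rmorphism D -> M})
    (iota : {rmorphism k -> {fraction D}}) (iota' : {rmorphism k -> M})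
    (s t u v : {fraction D}) (S T U V : M) :
  (forall c, specializes phi (iota c) (iota' c)) ->
  specializes phi s S -> specializes phi t T ->
  specializes phi u U -> specializes phi v V ->
  forall g, specializes phi (ev4 iota g s t u v) (ev4 iota' g S T U V).
Proof.
move=> hc hs ht hu hv; elim/mpoly4_ind => [c||||| p q hp hq|p q hp hq].
- by rewrite !ev4C.
- by rewrite !ev4S.
- by rewrite !ev4T.
- by rewrite !ev4U.
- by rewrite !ev4V.
- by rewrite !ev4D; apply: specD.
by rewrite !ev4M; apply: specM.
Qed.

(** * The subfield generated by s, t, u, v *)

Section Generated.
Context (k L : fieldType) (iota : {rmorphism k -> L}) (s t u v : L).
Notation ev g := (ev4 iota g s t u v).

Definition generated (w : L) := exists g1 g2 : mpoly4 k,
  ev g2 != 0 /\ w = ev g1 / ev g2.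

Lemma gen_ev g : generated (ev g).
Proof.
by exists g, 1; rewrite ev4E rmorph1 oner_eq0 divr1.
Qed.

Lemma gen_s : generated s. Proof. by have := gen_ev (varS k); rewrite ev4S. Qed.
Lemma gen_t : generated t. Proof. by have := gen_ev (varT k); rewrite ev4T. Qed.
Lemma gen_u : generated u. Proof. by have := gen_ev (varU k); rewrite ev4U. Qed.
Lemma gen_v : generated v. Proof. by have := gen_ev (varV k); rewrite ev4V. Qed.
Lemma genC c : generated (iota c).
Proof. by have := gen_ev c%:P%:P%:P%:P; rewrite ev4C. Qed.
Lemma gen1 : generated 1. Proof. by rewrite -(rmorph1 iota); apply: genC. Qed.

Lemma genD a b : generated a -> generated b -> generated (a + b).
Proof.
move=> [n [d [d0 ->]]] [n' [d' [d0' ->]]].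
exists (n * d' + n' * d), (d * d'); rewrite ev4D !ev4M mulf_neq0 //.
by split=> //; field; rewrite d0 d0'.
Qed.

Lemma genM a b : generated a -> generated b -> generated (a * b).
Proof.
move=> [n [d [d0 ->]]] [n' [d' [d0' ->]]].
exists (n * n'), (d * d'); rewrite !ev4M mulf_neq0 //.
by split=> //; field; rewrite d0 d0'.
Qed.

Lemma genN a : generated a -> generated (- a).
Proof.
move=> ga; rewrite -mulN1r; apply: genM ga.
by rewrite -(rmorphN1 iota); apply: genC.
Qed.

Lemma genX a n : generated a -> generated (a ^+ n).
Proof.
by move=> ga; elim: n => [|n IHn]; [exact: gen1 | rewrite exprS; apply: genM].
Qed.

Lemma genV a : generated a -> generated a^-1.
Proof.
move=> [n [d [d0 ->]]]; have [n0|n0] := eqVneq (ev n) 0.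
  by rewrite n0 mul0r invr0 -(rmorph0 iota); apply: genC.
by exists d, n; rewrite invf_div.
Qed.

Local Ltac gen_tac := repeat first
  [ assumption | exact: gen_s | exact: gen_t | exact: gen_u | exact: gen_v
  | exact: genC | exact: gen1 | apply: genV | apply: genN | apply: genD
  | apply: genX | apply: genM ].

Lemma gen_inv_x i : generated (inv_x (iota i) u v s t).
Proof. by rewrite /inv_x /P1 /P3 /comb /a1 /b1 /c1 /a3 /b3 /c3; gen_tac. Qed.

Lemma gen_inv_y i : generated (inv_y (iota i) u v s t).
Proof. by rewrite /inv_y /P2 /P3 /comb /a2 /b2 /c2 /a3 /b3 /c3; gen_tac. Qed.

End Generated.

(** * Nonvanishing at the generic point *)

Section PolyNonvanishing.
Context (B : idomainType) (i w : B).

Lemma disc_polyX_neq0 : w ^+ 2 - 1 != 0 -> disc w%:P 'X != 0.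
Proof.
move=> w1; rewrite /disc !mulf_neq0 //.
- by rewrite -polyC_exp -polyC1 -polyCB polyC_eq0.
- by rewrite -polyC1 subX2_neq0.
by rewrite -opprB oppr_eq0 -polyC_exp subX2_neq0.
Qed.

Lemma a3_polyX_neq0 : 1 - i != 0 -> a3 i%:P w%:P 'X != 0.
Proof.
by move=> i1; rewrite /a3 mulf_neq0 ?polyXsubC_eq0 // -polyC1 -polyCB polyC_eq0.
Qed.

Lemma a2_polyX_neq0 : w * (w + i) != 0 -> a2 i%:P w%:P 'X != 0.
Proof.
(* At V = 0 the polynomial [a2] takes the value w (w + i). *)
apply: contra_neq => /(congr1 (horner_eval 0)).
rewrite rmorph_a2 /= /horner_eval !hornerC hornerX /a2 => <-; ring.
Qed.

End PolyNonvanishing.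

(** In the form p S + q, independence of 1 and S reduces nonvanishing to that of p. *)
Lemma rmorph_comb (R R' : comNzRingType) (j : {rmorphism R -> R'})
    (i u v t a b c : R) (s : R') :
  comb (j i) (j u) (j v) s (j t) (j a) (j b) (j c)
  = j ((v ^+ 2 - 1) * a) * s
    + j ((u ^+ 2 - 1) * t * b + i * (u ^+ 2 - v ^+ 2) * c).
Proof.
by rewrite combE !(rmorphB, rmorphD, rmorphM, rmorphXn, rmorph1).
Qed.

(** The characteristic enters here: i = 1 would give - 1 = i^2 = 1. *)
Lemma one_sub_sqrtN1_neq0 (k : fieldType) (i : k) :
  2%N \notin [pchar k] -> i ^+ 2 = -1 -> 1 - i != 0.
Proof.
move=> hchar i2; apply: contra hchar; rewrite subr_eq0 => /eqP i1.
by rewrite inE /= -[2%:R]/(1 + 1) addr_eq0 -i2 -i1 expr1n.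
Qed.

(** * k(x, y, v) as the function field of X *)

Section Assembly.
Context (k : fieldType) (i : k).
Hypotheses (hchar : 2%N \notin [pchar k]) (i2 : i ^+ 2 = -1).
Context (M : fieldType) (j : {rmorphism mpoly3 k -> M}) (S : M).
Hypotheses (inj : injective j).
Hypothesis jS : j (s2_den k) * S ^+ 2 = j (s2_num k).
Hypothesis ind : forall p q, j p * S + j q = 0 -> p = 0.
Let T : M := j 'X%:P%:P.
Let U : M := j 'X%:P.
Let V : M := j 'X.
Let iM := scalar3 j.
Let I := iM i.

Let nz (p : mpoly3 k) : p != 0 -> j p != 0.
Proof. by apply: contra_neq => jp; apply: inj; rewrite jp rmorph0. Qed.

Let I2 : I ^+ 2 = -1.
Proof. by rewrite -(rmorphXn iM) i2 rmorphN1. Qed.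

Let U0 : U != 0. Proof. by apply: nz; rewrite polyC_eq0 polyX_eq0. Qed.
Let V0 : V != 0. Proof. by apply: nz; rewrite polyX_eq0. Qed.
Let ST : X_eq S T U V = 0.
Proof.
by rewrite X_eq_den_num -(rmorph_den j) -(rmorph_num j) -jS subrr.
Qed.
Let iD : mpoly3 k := i%:P%:P%:P.

Let d0 : disc U V != 0.
Proof.
rewrite -(rmorph_disc j); apply/nz/disc_polyX_neq0.
by rewrite -polyC1 subX2_neq0.
Qed.

Let comb_neq0 (a b c : mpoly3 k) :
  a != 0 -> comb I U V S T (j a) (j b) (j c) != 0.
Proof.
have e := rmorph_comb j iD 'X%:P 'X 'X%:P%:P a b c S.
move=> a0; apply/eqP => c0; have /eqP := ind (etrans (esym e) c0).
by apply/negP; rewrite mulf_neq0 // -polyC1 subX2_neq0.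
Qed.

Let P2_0 : P2 I U V S T != 0.
Proof.
rewrite /P2 -(rmorph_a2 j iD 'X%:P 'X) -(rmorph_b2 j iD 'X%:P 'X).
rewrite -(rmorph_c2 j iD 'X%:P 'X).
apply/comb_neq0/a2_polyX_neq0; rewrite mulf_neq0 ?polyX_eq0 //.
by rewrite -[i%:P%:P]opprK -polyCN polyXsubC_eq0.
Qed.

Let P3_0 : P3 I U V S T != 0.
Proof.
rewrite /P3 -(rmorph_a3 j iD 'X%:P 'X) -(rmorph_b3 j iD 'X%:P 'X).
rewrite -(rmorph_c3 j iD 'X%:P 'X).
apply/comb_neq0/a3_polyX_neq0.
rewrite -polyC1 -polyCB polyC_eq0 -polyC1 -polyCB polyC_eq0.
exact: one_sub_sqrtN1_neq0.
Qed.

Let X := inv_x I U V S T.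
Let Y := inv_y I U V S T.
Let phi := ev3_rmorphism iM X Y V.

Notation L := {fraction mpoly3 k}.
Let x : L := tofrac 'X%:P%:P.
Let y : L := tofrac 'X%:P.
Let v : L := tofrac 'X.
Let iota : {rmorphism k -> L} := scalar3 (@tofrac (mpoly3 k)).
Let u : L := conic_u x y v.
Let s : L := param_s (iota i) u v x y.
Let t : L := param_t (iota i) u v x y.

Let spC c : specializes phi (iota c) (iM c).
Proof.
by have := spec_tofrac phi c%:P%:P%:P; rewrite /phi -ev3E ev3C.
Qed.
Let spx : specializes phi x X.
Proof. by have := spec_tofrac phi 'X%:P%:P; rewrite /phi -ev3E ev3X. Qed.
Let spy : specializes phi y Y.
Proof. by have := spec_tofrac phi 'X%:P; rewrite /phi -ev3E ev3Y. Qed.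
Let spv : specializes phi v V.
Proof. by have := spec_tofrac phi 'X; rewrite /phi -ev3E ev3Z. Qed.
Let spi := spC i.

Let iota2 : iota i ^+ 2 = -1.
Proof. by rewrite -(rmorphXn iota) i2 rmorphN1. Qed.

Lemma ev4_fX (K K' : fieldType) (f : {rmorphism K -> K'}) (a b c d : K') :
  ev4 f (fX K) a b c d = X_eq a b c d.
Proof.
by rewrite ev4E fXE rmorph_X_eq -!ev4E ev4S ev4T ev4U ev4V.
Qed.

Let spu : specializes phi u U.
Proof. exact: (specializes_param_u I2 U0 V0 P2_0 P3_0 ST spx spy spv). Qed.
Let sps : specializes phi s S.
Proof.
exact: (specializes_param_s I2 U0 V0 d0 P2_0 P3_0 ST spi spx spy spv).
Qed.
Let spt : specializes phi t T.
Proof.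
exact: (specializes_param_t I2 U0 V0 d0 P2_0 P3_0 ST spi spx spy spv).
Qed.
Let on_X : X_eq s t u v = 0.
Proof. exact: (param_on_X iota2 I2 U0 V0 d0 P2_0 P3_0 ST spi spx spy spv). Qed.
Let xE : inv_x (iota i) u v s t = x.
Proof. exact: (param_x iota2 I2 U0 V0 d0 P2_0 P3_0 ST spi spx spy spv). Qed.
Let yE : inv_y (iota i) u v s t = y.
Proof. exact: (param_y iota2 I2 U0 V0 d0 P2_0 P3_0 ST spi spx spy spv). Qed.

Lemma param_function_field : is_function_field_of_X iota s t u v.
Proof.
split.
- rewrite ev4_fX; exact: on_X.
(* A relation in [L] specializes to one at the generic point, hence is a multiple of [fX]. *)
- move=> g g0; apply: (ker_generic_point inj jS ind).
  have := spec_ev4 spC sps spt spu spv g.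
  by rewrite g0 => /spec0_eq0.
move=> w; have [n [d [_ ->]]] := fraction_div w.
(* The inverse formulas express x and y through s, t, u, v, and v is itself a generator. *)
have gen_poly p : generated iota s t u v (tofrac p).
  elim/mpoly3_ind: p => [c||||p q hp hq|p q hp hq].
  - exact: (genC iota).
  - by rewrite -/x -xE; apply: gen_inv_x.
  - by rewrite -/y -yE; apply: gen_inv_y.
  - exact: gen_v.
  - by rewrite tofracD; apply: genD.
  by rewrite tofracM; apply: genM.
by apply: genM; [|apply: genV].
Qed.

Lemma param_purely_transcendental : purely_transcendental3 iota.
Proof.
exists x, y, v; split=> [g g0 | w].
  (* Evaluation at x, y, v is the embedding [tofrac], which is injective. *)
  by rewrite (ev3_scalar3 (@tofrac (mpoly3 k))) tofrac_eq0.
have [n [d [d0' ->]]] := fraction_div w.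
by exists n, d; rewrite !(ev3_scalar3 (@tofrac (mpoly3 k))) tofrac_eq0.
Qed.

End Assembly.

Theorem mainTheorem1 (k : fieldType) (hchar : 2%N \notin [pchar k])
  (hi : exists i : k, i ^+ 2 = -1) :
  exists (L : fieldType) (iota : {rmorphism k -> L}) (s t u v : L),
    is_function_field_of_X iota s t u v /\ purely_transcendental3 iota.
Proof.
have [i i2] := hi.
have [M [j [S [inj jS ind]]]] := generic_point k.
do 6!eexists; split; last exact: param_purely_transcendental.
exact: (param_function_field hchar i2 inj jS ind).
Qed.
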